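(* Let $\mathcal{D}$ be a triangulated category and $(\mathcal{D}^{\leq 0},\mathcal{D}^{\geq 1})$ a $t$-structure on $\mathcal{D}$ with heart $\mathcal{H}$. If $(\mathcal{D}^{\leq 0},\mathcal{D}^{\geq 1})$ is nondegenerate, then there exist bijective correspondences between (1) the set of torsion classes in $\mathcal{H}$, and (2) the set of intermediate preaisles in $\mathcal{D}$.
   Context: All subcategories are full, additive and closed under isomorphisms. For a $t$-structure $(\mathcal{D}^{\leq 0},\mathcal{D}^{\geq 1})$ put $\mathcal{D}^{\leq n}=\mathcal{D}^{\leq 0}[-n]$, $\mathcal{D}^{\geq n+1}=\mathcal{D}^{\geq 1}[-n]$; the heart is $\mathcal{H}=\mathcal{D}^{\leq 0}\cap\mathcal{D}^{\geq 0}$. The $t$-structure is nondegenerate if $\bigcap_{n\in\mathbb{Z}}\mathcal{D}^{\leq n}=0=\bigcap_{n\in\mathbb{Z}}\mathcal{D}^{\geq n}$. A torsion class in an abelian category is a subcategory closed under extensions and quotients. A preaisle in $\mathcal{D}$ is a subcategory $\mathcal{U}$ closed under extensions (the middle term of any exact triangle with outer terms in $\mathcal{U}$ is in $\mathcal{U}$) with $\mathcal{U}[1]\subseteq\mathcal{U}$. A preaisle $\mathcal{U}$ is intermediate if $\mathcal{D}^{\leq -1}\subseteq\mathcal{U}\subseteq\mathcal{D}^{\leq 0}$. *)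

(* Defs.v *)
From mathcomp Require Import all_boot all_algebra.

Set Implicit Arguments.
Unset Strict Implicit.
Unset Printing Implicit Defensive.

Import GRing.Theory.
Local Open Scope ring_scope.

Reserved Notation "g \oc f" (at level 40, left associativity).

Record preadditive := Preadditive {
  obj :> Type;
  hom : obj -> obj -> zmodType;
  idm : forall X, hom X X;
  comp : forall X Y Z, hom Y Z -> hom X Y -> hom X Z;
  comp_idl : forall X Y (f : hom X Y), comp (idm Y) f = f;
  comp_idr : forall X Y (f : hom X Y), comp f (idm X) = f;
  compA : forall X Y Z W (h : hom Z W) (g : hom Y Z) (f : hom X Y),
    comp h (comp g f) = comp (comp h g) f;
  compDl : forall X Y Z (g1 g2 : hom Y Z) (f : hom X Y),
    comp (g1 + g2) f = comp g1 f + comp g2 f;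
  compDr : forall X Y Z (g : hom Y Z) (f1 f2 : hom X Y),
    comp g (f1 + f2) = comp g f1 + comp g f2
}.

Arguments hom {p} X Y.
Arguments idm {p} X.
Arguments comp {p X Y Z} g f.

Notation "g \oc f" := (comp g f).

Section Preadditive.
Variable C : preadditive.

Definition is_iso (X Y : C) (f : hom X Y) : Prop :=
  exists g : hom Y X, g \oc f = idm X /\ f \oc g = idm Y.

Definition isomorphic (X Y : C) : Prop := exists f : hom X Y, is_iso f.

Definition is_zero (X : C) : Prop :=
  (forall (Y : C) (f : hom X Y), f = 0) /\ (forall (Y : C) (f : hom Y X), f = 0).

Definition is_biproduct (X Y B : C) : Prop :=
  exists (i : hom X B) (j : hom Y B) (p : hom B X) (q : hom B Y),
    [/\ p \oc i = idm X, q \oc j = idm Y, p \oc j = 0, q \oc i = 0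
      & i \oc p + j \oc q = idm B].

Definition is_additive : Prop :=
  (exists X : C, is_zero X) /\ (forall X Y : C, exists B, is_biproduct X Y B).

Definition is_epi (X Y : C) (g : hom X Y) : Prop :=
  forall (Z : C) (u v : hom Y Z), u \oc g = v \oc g -> u = v.

Definition is_kernel (X Y Z : C) (f : hom X Y) (g : hom Y Z) : Prop :=
  g \oc f = 0 /\
  forall (W : C) (w : hom W Y), g \oc w = 0 -> exists! u : hom W X, f \oc u = w.

Definition is_cokernel (X Y Z : C) (f : hom X Y) (g : hom Y Z) : Prop :=
  g \oc f = 0 /\
  forall (W : C) (w : hom Y W), w \oc f = 0 -> exists! u : hom Z W, u \oc g = w.

Definition short_exact (X Y Z : C) (f : hom X Y) (g : hom Y Z) : Prop :=
  is_kernel f g /\ is_cokernel f g.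

(* A full subcategory is given by its class of objects. *)
Definition subcat := C -> Prop.

Definition subcat_incl (P Q : subcat) : Prop := forall X, P X -> Q X.

Definition is_subcategory (P : subcat) : Prop :=
  [/\ forall X Y, isomorphic X Y -> P X -> P Y,
      forall X, is_zero X -> P X
    & forall X Y B, is_biproduct X Y B -> P X -> P Y -> P B].

(* Meant for an abelian category C, where the quotients of X are the targets of
   the epimorphisms from X. *)
Definition is_torsion_class (T : subcat) : Prop :=
  [/\ is_subcategory T,
      forall (X Y Z : C) (f : hom X Y) (g : hom Y Z),
        short_exact f g -> T X -> T Z -> T Y
    & forall (X Y : C) (g : hom X Y), is_epi g -> T X -> T Y].

Definition full_sub (P : subcat) : preadditive :=
  @Preadditive {X : C | P X} (fun X Y => hom (sval X) (sval Y))
    (fun X => idm (sval X)) (fun X Y Z g f => g \oc f)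
    (fun X Y f => comp_idl f) (fun X Y f => comp_idr f)
    (fun X Y Z W h g f => compA h g f)
    (fun X Y Z g1 g2 f => compDl g1 g2 f)
    (fun X Y Z g f1 f2 => compDr g f1 f2).

End Preadditive.

Record additive_functor (C C' : preadditive) := AdditiveFunctor {
  fobj :> C -> C';
  fmap : forall X Y : C, hom X Y -> hom (fobj X) (fobj Y);
  fmap_id : forall X, fmap (idm X) = idm (fobj X);
  fmap_comp : forall X Y Z (g : hom Y Z) (f : hom X Y),
    fmap (g \oc f) = fmap g \oc fmap f;
  fmapD : forall X Y (f g : hom X Y), fmap (f + g) = fmap f + fmap g
}.

Arguments fmap {C C'} a {X Y} f.

Definition quasi_inverse (C C' : preadditive)
    (F : additive_functor C C') (G : additive_functor C' C) : Prop :=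
  (exists a : forall X : C, hom X (G (F X)),
     (forall X, is_iso (a X)) /\
     (forall X Y (f : hom X Y), a Y \oc f = fmap G (fmap F f) \oc a X)) /\
  (exists b : forall X : C', hom (F (G X)) X,
     (forall X, is_iso (b X)) /\
     (forall X Y (f : hom X Y), b Y \oc fmap F (fmap G f) = f \oc b X)).

(* The shift is only required to be an equivalence, not an automorphism, so
   negative shifts are powers of a chosen quasi-inverse; the subcategories P[n]
   below are closed under isomorphism and do not depend on that choice. *)
Record triangulated := Triangulated {
  tri_cat :> preadditive;
  tri_additive : is_additive tri_cat;
  shift : additive_functor tri_cat tri_cat;
  unshift : additive_functor tri_cat tri_cat;
  shift_equiv : quasi_inverse shift unshift;
  distinguished : forall X Y Z : tri_cat,
    hom X Y -> hom Y Z -> hom Z (shift X) -> Prop;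
  dist_iso : forall (X Y Z X' Y' Z' : tri_cat)
      (f : hom X Y) (g : hom Y Z) (h : hom Z (shift X))
      (f' : hom X' Y') (g' : hom Y' Z') (h' : hom Z' (shift X'))
      (a : hom X X') (b : hom Y Y') (c : hom Z Z'),
    is_iso a -> is_iso b -> is_iso c ->
    b \oc f = f' \oc a -> c \oc g = g' \oc b -> fmap shift a \oc h = h' \oc c ->
    distinguished f g h -> distinguished f' g' h';
  dist_id : forall X Z : tri_cat, is_zero Z ->
    distinguished (idm X) (0 : hom X Z) (0 : hom Z (shift X));
  dist_cone : forall (X Y : tri_cat) (f : hom X Y),
    exists (Z : tri_cat) (g : hom Y Z) (h : hom Z (shift X)),
      distinguished f g h;
  dist_rot : forall (X Y Z : tri_cat)
      (f : hom X Y) (g : hom Y Z) (h : hom Z (shift X)),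
    distinguished f g h <-> distinguished g h (- fmap shift f);
  dist_map : forall (X Y Z X' Y' Z' : tri_cat)
      (f : hom X Y) (g : hom Y Z) (h : hom Z (shift X))
      (f' : hom X' Y') (g' : hom Y' Z') (h' : hom Z' (shift X'))
      (a : hom X X') (b : hom Y Y'),
    distinguished f g h -> distinguished f' g' h' -> b \oc f = f' \oc a ->
    exists c : hom Z Z', c \oc g = g' \oc b /\ fmap shift a \oc h = h' \oc c;
  octahedral : forall (X Y Z X' Y' Z' : tri_cat) (f : hom X Y) (g : hom Y Z)
      (f1 : hom Y Z') (f2 : hom Z' (shift X))
      (g1 : hom Z X') (g2 : hom X' (shift Y))
      (k1 : hom Z Y') (k2 : hom Y' (shift X)),
    distinguished f f1 f2 -> distinguished g g1 g2 ->
    distinguished (g \oc f) k1 k2 ->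
    exists (u : hom Z' Y') (v : hom Y' X'),
      distinguished u v (fmap shift f1 \oc g2) /\
      [/\ u \oc f1 = k1 \oc g, k2 \oc u = f2,
          v \oc k1 = g1 & g2 \oc v = fmap shift f \oc k2]
}.

Section Triangulated.
Variable D : triangulated.

Definition shiftz (n : int) (X : D) : D :=
  match n with
  | Posz m => iter m (shift D) X
  | Negz m => iter m.+1 (unshift D) X
  end.

Definition subcat_shift (P : subcat D) (n : int) : subcat D :=
  fun X => exists2 Y, P Y & isomorphic X (shiftz n Y).

Definition is_preaisle (U : subcat D) : Prop :=
  [/\ is_subcategory U,
      forall (X Y Z : D) (f : hom X Y) (g : hom Y Z) (h : hom Z (shift D X)),
        distinguished f g h -> U X -> U Z -> U Y
    & subcat_incl (subcat_shift U 1) U].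

Record t_structure := TStructure {
  tle0 : subcat D;
  tge1 : subcat D;
  tle0_subcategory : is_subcategory tle0;
  tge1_subcategory : is_subcategory tge1;
  t_orth : forall X Y (f : hom X Y), tle0 X -> tge1 Y -> f = 0;
  tle0_shift : subcat_incl (subcat_shift tle0 1) tle0;
  tge1_shift : subcat_incl (subcat_shift tge1 (-1)) tge1;
  t_trunc : forall X : D,
    exists (A B : D) (f : hom A X) (g : hom X B) (h : hom B (shift D A)),
      [/\ distinguished f g h, tle0 A & tge1 B]
}.

Variable t : t_structure.

(* D^{<= n} = D^{<= 0}[-n], and D^{>= n} = D^{>= 1}[-(n-1)]. *)
Definition tle (n : int) : subcat D := subcat_shift (tle0 t) (- n).
Definition tge (n : int) : subcat D := subcat_shift (tge1 t) (- (n - 1)).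

Definition heart : preadditive := full_sub (fun X => tle0 t X /\ tge 0 X).

Definition t_nondegenerate : Prop :=
  (forall X, (forall n : int, tle n X) <-> is_zero X) /\
  (forall X, (forall n : int, tge n X) <-> is_zero X).

Definition is_intermediate_preaisle (U : subcat D) : Prop :=
  [/\ is_preaisle U, subcat_incl (tle (-1)) U & subcat_incl U (tle0 t)].

End Triangulated.

(* Main.v *)
From mathcomp Require Import all_boot ssralg ssrint boolp.
Require Import Defs.

(** Write [P * Q] for the class of objects [X] that lie in an exact triangle
   [A -> X -> B -> A[1]] with [A] in [P] and [B] in [Q]. To a torsion class [T]
   of the heart corresponds the preaisle [D^{<=-1} * T], that is, the class of
   the [X] in [D^{<=0}] whose cohomology [H^0 X] lies in [T]; to an
   intermediate preaisle [U] corresponds its intersection with the heart.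

   The product [*] is associative by the octahedral axiom, so [D^{<=-1} * T] is
   extension-closed as soon as its two factors are and can be exchanged:
   [T * D^{<=-1}] is contained in [D^{<=-1} * T] ([ext_closed_ext]). This
   exchange is where closure of [T] under quotients enters: if [W] is in
   [T * D^{<=-1}] with [B -> W] the map from an object of [T], then
   [B -> W -> H^0 W] is an epimorphism of the heart ([ext_heart_image_lt0]). In
   this way no kernel or image has to be constructed in the heart.

   Conversely let [U] be an intermediate preaisle. If [g : X -> Y] is an
   epimorphism of the heart, its cone lies in [D^{<=-1}], hence in [U], so [Y]
   is in [U] when [X] is ([heart_epi_cone]). If [f : X -> Y] has cokernel [Z] in
   the heart, then [Z] is [H^0] of the cone of [f], so that the cone is in
   [D^{<=-1} * U] and [Y] is in [U] when [X] and [Z] are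
   ([torsion_of_torsion]).

   The two constructions are mutually inverse. An object of the heart which is
   in [D^{<=-1} * T] is isomorphic to the corresponding object of [T], since
   there is no nonzero map from [D^{<=-1}] to the heart. For [X] in [U], the
   rotated truncation triangle shows that [H^0 X] is an extension of an object
   of [D^{<=-2}] by [X], hence in [U]. *)

Set Implicit Arguments.
Unset Strict Implicit.
Unset Printing Implicit Defensive.

Import GRing.Theory.
Local Open Scope ring_scope.

(** * Preadditive categories and additive functors *)

Section PreadditiveLemmas.
Variable C : preadditive.

Lemma comp0l (X Y Z : C) (f : hom X Y) : (0 : hom Y Z) \oc f = 0.
Proof. by apply: (addrI (0 \oc f)); rewrite -compDl !addr0. Qed.

Lemma comp0r (X Y Z : C) (g : hom Y Z) : g \oc (0 : hom X Y) = 0.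
Proof. by apply: (addrI (g \oc 0)); rewrite -compDr !addr0. Qed.

Lemma compNl (X Y Z : C) (g : hom Y Z) (f : hom X Y) :
  (- g) \oc f = - (g \oc f).
Proof. by apply: (addrI (g \oc f)); rewrite -compDl !subrr comp0l. Qed.

Lemma compNr (X Y Z : C) (g : hom Y Z) (f : hom X Y) :
  g \oc (- f) = - (g \oc f).
Proof. by apply: (addrI (g \oc f)); rewrite -compDr !subrr comp0r. Qed.

Lemma is_zeroP (X : C) : idm X = 0 -> is_zero X.
Proof.
move=> X0; split=> Y f; first by rewrite -(comp_idr f) X0 comp0r.
by rewrite -(comp_idl f) X0 comp0l.
Qed.

Lemma is_iso_idm (X : C) : is_iso (idm X).
Proof. by exists (idm X); rewrite comp_idl. Qed.

Lemma isomorphic_refl (X : C) : isomorphic X X.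
Proof. by exists (idm X); exact: is_iso_idm. Qed.

Lemma isomorphic_sym (X Y : C) : isomorphic X Y -> isomorphic Y X.
Proof. by case=> f [g [gf fg]]; exists g, f. Qed.

Lemma isomorphic_trans (X Y Z : C) :
  isomorphic X Y -> isomorphic Y Z -> isomorphic X Z.
Proof.
case=> f [f' [f'f ff']] [g [g' [g'g gg']]]; exists (g \oc f), (f' \oc g').
split.
  by rewrite compA -[_ \oc g' \oc g]compA g'g comp_idr.
by rewrite compA -[_ \oc f \oc f']compA ff' comp_idr.
Qed.

Lemma iso_epi (X Y Z : C) (f : hom X Y) (u v : hom Y Z) :
  is_iso f -> u \oc f = v \oc f -> u = v.
Proof.
by case=> g [_ fg] e; rewrite -(comp_idr u) -(comp_idr v) -fg !compA e.
Qed.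

Lemma iso_mono (X Y Z : C) (f : hom Y Z) (u v : hom X Y) :
  is_iso f -> f \oc u = f \oc v -> u = v.
Proof.
by case=> g [gf _] e; rewrite -(comp_idl u) -(comp_idl v) -gf -!compA e.
Qed.

End PreadditiveLemmas.

Section Functors.
Variables C C' : preadditive.
Variable F : additive_functor C C'.

Lemma fmap0 (X Y : C) : fmap F (0 : hom X Y) = 0.
Proof. by apply: (addrI (fmap F 0)); rewrite -fmapD !addr0. Qed.

Lemma fmapN (X Y : C) (f : hom X Y) : fmap F (- f) = - fmap F f.
Proof. by apply: (addrI (fmap F f)); rewrite -fmapD !subrr fmap0. Qed.

Variable G : additive_functor C' C.
Hypothesis FG : quasi_inverse F G.

Lemma quasi_inverse_faithful (X Y : C) (f g : hom X Y) :
  fmap F f = fmap F g -> f = g.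
Proof.
case: FG => -[a [aiso anat]] _ e.
by apply: (iso_mono (aiso Y)); rewrite !anat e.
Qed.

Lemma quasi_inverse_full (X Y : C) (k : hom (F X) (F Y)) :
  exists f : hom X Y, fmap F f = k.
Proof.
case: FG => -[a [aiso anat]] [b [biso bnat]].
have [a' [a'a aa']] := aiso Y.
exists (a' \oc (fmap G k \oc a X)).
(* By naturality of the counit [b] it is enough to compare images under [G]. *)
apply: (iso_epi (biso (F X))); rewrite -!bnat; congr (_ \oc fmap F _).
apply: (iso_epi (aiso X)).
by rewrite -anat compA aa' comp_idl.
Qed.

End Functors.

(** * Distinguished triangles *)

Local Notation "X [1]" := (shift _ X) (at level 2, format "X [1]").

Section Triangles.
Variable D : triangulated.

Lemma shift_faithful (X Y : D) (f g : hom X Y) :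
  fmap (shift D) f = fmap (shift D) g -> f = g.
Proof. exact: (quasi_inverse_faithful (shift_equiv D)). Qed.

(** Fullness of the shift, with the sign under which maps occur in rotated
   triangles. *)
Lemma shift_full (X Y : D) (k : hom X[1] Y[1]) :
  exists f : hom X Y, - fmap (shift D) f = k.
Proof.
have [f e] := quasi_inverse_full (shift_equiv D) (- k).
by exists f; rewrite e opprK.
Qed.

Lemma shift_ess_surj (X : D) : isomorphic X (unshift D X)[1].
Proof.
by have [_ [b [biso _]]] := shift_equiv D; apply: isomorphic_sym; exists (b X).
Qed.

Lemma shift_zero (X : D) : is_zero X -> is_zero X[1].
Proof.
by case=> X0 _; apply: is_zeroP; rewrite -fmap_id (X0 _ (idm X)) fmap0.
Qed.

Lemma dist_rotV (X Y Z : D) (f : hom X Y) (g : hom Y Z) (h : hom Z X[1]) :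
  distinguished g h (- fmap (shift D) f) -> distinguished f g h.
Proof. exact: (dist_rot f g h).2. Qed.

Section OneTriangle.
Variables (X Y Z : D) (f : hom X Y) (g : hom Y Z) (h : hom Z X[1]).
Hypothesis fgh : distinguished f g h.

Lemma dist_rot1 : distinguished g h (- fmap (shift D) f).
Proof. exact: (dist_rot f g h).1. Qed.

(** [w] is a morphism from the triangle to the trivial one on [0 -> W -> W]. *)
Lemma dist_factor_r (W : D) (w : hom Y W) :
  w \oc f = 0 -> exists u : hom Z W, u \oc g = w.
Proof.
move=> wf; have [O O0] := (tri_additive D).1.
have dO : distinguished (0 : hom O W) (idm W) (0 : hom W O[1]).
  by apply: dist_rotV; rewrite fmap0 oppr0; apply/dist_id/shift_zero.
have [u [ug _]] := dist_map (a := 0) (b := w) fgh dO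
  (etrans wf (esym (comp0l _ _))).
by exists u; rewrite ug comp_idl.
Qed.

(** [w] is a morphism from the trivial triangle on [W -> W -> 0]; the shifted
   lift is read off after rotating both triangles. *)
Lemma dist_factor_l (W : D) (w : hom W Y) :
  g \oc w = 0 -> exists u : hom W X, f \oc u = w.
Proof.
move=> gw; have [O O0] := (tri_additive D).1.
have dO : distinguished (0 : hom W O) 0 (- fmap (shift D) (idm W)).
  by apply: (dist_rot _ _ _).1; apply: dist_id.
have [c [_ ec]] := dist_map (a := w) (b := 0) dO dist_rot1
  (etrans (comp0l _ _) (esym gw)).
have [u uc] := shift_full c; exists (- u); apply: shift_faithful.
move: ec; rewrite -uc fmap_id compNr comp_idr compNl fmap_comp fmapN.
by move=> /oppr_inj.
Qed.

Lemma dist_comp0 : g \oc f = 0.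
Proof.
have [O O0] := (tri_additive D).1.
have [c [ec _]] := dist_map (a := idm X) (b := f) (dist_id X O0) fgh erefl.
by rewrite -ec comp0r.
Qed.

End OneTriangle.

Lemma dist_comp0_rot (X Y Z : D) (f : hom X Y) (g : hom Y Z) (h : hom Z X[1]) :
  distinguished f g h -> h \oc g = 0.
Proof. by move/dist_rot1; apply: dist_comp0. Qed.

(** Each of the three maps is minus a shift, so that undoing three rotations
   gives a triangle on [X], [Y] and [Z]. *)
Lemma dist_unshift (X Y Z : D) (f : hom X[1] Y[1]) (g : hom Y[1] Z[1])
    (h : hom Z[1] X[1][1]) :
  distinguished f g h ->
  exists (f' : hom X Y) (g' : hom Y Z) (h' : hom Z X[1]),
    distinguished f' g' h'.
Proof.
have [f' <-] := shift_full f; have [g' <-] := shift_full g.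
have [h' <-] := shift_full h => d; exists f', g', h'.
by do 3!apply: dist_rotV.
Qed.

Lemma dist_shift (X Y Z : D) (f : hom X Y) (g : hom Y Z) (h : hom Z X[1]) :
  distinguished f g h ->
  exists (f' : hom X[1] Y[1]) (g' : hom Y[1] Z[1]) (h' : hom Z[1] X[1][1]),
    distinguished f' g' h'.
Proof.
by move=> /dist_rot1/dist_rot1/dist_rot1 d; do 3!eexists; exact: d.
Qed.

(** The cone of [g] is isomorphic to some [X[1]]; the rotated triangle then
   rotates back to one starting at [X]. *)
Lemma dist_cocone (Y Z : D) (g : hom Y Z) :
  exists (X : D) (f : hom X Y) (h : hom Z X[1]), distinguished f g h.
Proof.
have [Q [q [r d]]] := dist_cone g.
have [c [c' [c'c cc']]] := shift_ess_surj Q.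
have [f ef] := shift_full (r \oc c').
exists (unshift D Q), f, (c \oc q); apply: dist_rotV.
apply: (dist_iso (is_iso_idm Y) (is_iso_idm Z) (c := c) _ _ _ _ d).
- by exists c'.
- by rewrite comp_idl comp_idr.
- by rewrite comp_idr.
- by rewrite fmap_id comp_idl ef -compA c'c comp_idr.
Qed.

(** As [f = 0], the map [g] has a retraction [r]; as [(g r - 1) g = 0], the
   map [g r - 1] factors through a map from [X[1]] to [Z]. *)
Lemma dist_zero_fst (X Y Z : D) (f : hom X Y) (g : hom Y Z) (h : hom Z X[1]) :
  distinguished f g h -> f = 0 -> (forall u : hom X[1] Z, u = 0) -> is_iso g.
Proof.
move=> d f0 X1Z.
have [r rg] : exists r : hom Z Y, r \oc g = idm Y.
  by apply: (dist_factor_r d); rewrite f0 comp0r.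
exists r; split=> //; apply/eqP; rewrite -subr_eq0; apply/eqP.
have [u <-] : exists u : hom X[1] Z, u \oc h = g \oc r - idm Z.
  apply: (dist_factor_r (dist_rot1 d)).
  by rewrite compDl compNl -compA rg comp_idr comp_idl subrr.
by rewrite (X1Z u) comp0l.
Qed.

(** As [g = 0], the identity of [Z] factors through a map from [X[1]] to [Z], so
   that [Z = 0]. *)
Lemma dist_zero_snd (X Y Z : D) (f : hom X Y) (g : hom Y Z) (h : hom Z X[1]) :
  distinguished f g h -> g = 0 -> (forall u : hom X[1] Z, u = 0) -> is_iso f.
Proof.
move=> d g0 X1Z.
have Z0 : idm Z = 0.
  have [u <-] : exists u : hom X[1] Z, u \oc h = idm Z.
    by apply: (dist_factor_r (dist_rot1 d)); rewrite comp_idl.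
  by rewrite (X1Z u) comp0l.
have [s fs] : exists s : hom Y X, f \oc s = idm Y.
  by apply: (dist_factor_l d); rewrite g0 comp0l.
exists s; split=> //; apply/eqP; rewrite -subr_eq0; apply/eqP.
apply: shift_faithful; rewrite fmap0.
have [u <-] : exists u : hom X[1] Z,
    h \oc u = fmap (shift D) (s \oc f - idm X).
  apply: (dist_factor_l (dist_rot1 (dist_rot1 d))).
  rewrite compNl -fmap_comp compDr compNr compA fs comp_idl comp_idr subrr.
  by rewrite fmap0 oppr0.
by rewrite (X1Z u) comp0r.
Qed.

(** The cone [Z] of the inclusion [i] is isomorphic to [Y]: as [i] is a split
   monomorphism, [Z -> X[1]] is zero, so that [B -> Z] is an epimorphism; and
   the maps from [B] to [Z] and to [Y] factor through each other. *)
Lemma dist_biproduct (X Y B : D) :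
  is_biproduct X Y B ->
  exists (f : hom X B) (g : hom B Y) (h : hom Y X[1]), distinguished f g h.
Proof.
case=> i [j [p [q [pi qj pj qi ijpq]]]].
have [Z [g [h d]]] := dist_cone i.
have h0 : h = 0.
  have := dist_comp0_rot (dist_rot1 d); rewrite compNl => /eqP.
  rewrite oppr_eq0 => /eqP ih.
  by rewrite -(comp_idl h) -fmap_id -pi fmap_comp -compA ih comp0r.
have [u ug] := dist_factor_r d qi.
have gjq : g \oc (j \oc q) = g.
  have -> : j \oc q = idm B - i \oc p by rewrite -ijpq addrC addKr.
  by rewrite compDr compNr compA (dist_comp0 d) comp0l subr0 comp_idr.
have uiso : is_iso u.
  exists (g \oc j); split; last by rewrite compA ug.
  apply/eqP; rewrite -subr_eq0; apply/eqP.
  have [w <-] : exists w : hom X[1] Z, w \oc h = g \oc j \oc u - idm Z.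
    apply: (dist_factor_r (dist_rot1 d)).
    by rewrite compDl compNl -!compA ug gjq comp_idl subrr.
  by rewrite h0 comp0r.
exists i, q, 0; apply: (dist_iso (is_iso_idm X) (is_iso_idm B) uiso _ _ _ d).
- by rewrite comp_idl comp_idr.
- by rewrite comp_idr.
- by rewrite h0 comp0r comp0l.
Qed.

End Triangles.

(** * Classes of extensions *)

Section Extensions.
Variable D : triangulated.
Implicit Types P Q R : subcat D.

Definition iso_closed P : Prop := forall X Y, isomorphic X Y -> P X -> P Y.

Definition ext P Q : subcat D := fun X =>
  exists (A B : D) (f : hom A X) (g : hom X B) (h : hom B A[1]),
    [/\ distinguished f g h, P A & Q B].

Definition ext_closed P : Prop := subcat_incl (ext P P) P.

Lemma ext_mono P P' Q Q' :
  subcat_incl P P' -> subcat_incl Q Q' -> subcat_incl (ext P Q) (ext P' Q').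
Proof.
move=> PP' QQ' X [A [B [f [g [h [d PA QB]]]]]].
by exists A, B, f, g, h; split; [|apply: PP'|apply: QQ'].
Qed.

Lemma ext_iso P Q : iso_closed (ext P Q).
Proof.
move=> X Y [a ai] [A [B [f [g [h [d PA QB]]]]]].
have [b [ba ab]] := ai.
exists A, B, (a \oc f), (g \oc b), h; split=> //.
apply: (dist_iso (is_iso_idm A) ai (is_iso_idm B) _ _ _ d).
- by rewrite comp_idr.
- by rewrite -compA ba comp_idl comp_idr.
- by rewrite fmap_id comp_idl comp_idr.
Qed.

(** For [A -> M -> X], the cone [Z] of the composite is by the octahedral axiom
   an extension of the cones of the two maps. *)
Lemma ext_assoc_r P Q R :
  subcat_incl (ext (ext P Q) R) (ext P (ext Q R)).
Proof.
move=> X [M [C [g [g1 [g2 [dg [A [B [f [f1 [f2 [df PA QB]]]]]] RC]]]]]].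
have [Z [k1 [k2 dk]]] := dist_cone (g \oc f).
have [u [v [duv _]]] := octahedral df dg dk.
exists A, Z, (g \oc f), k1, k2; split=> //.
by exists B, C, u, v, (fmap (shift D) f1 \oc g2).
Qed.

(** For [X -> M -> C], the octahedral axiom relates the shifted cocones of the
   two maps and of their composite; the resulting triangle is then unshifted. *)
Lemma ext_assoc_l P Q R :
  subcat_incl (ext P (ext Q R)) (ext (ext P Q) R).
Proof.
move=> X [A [M [a [f [c [df PA [B [C [b [g [e [dg QB RC]]]]]]]]]]]].
have [E [k [l dk]]] := dist_cocone (g \oc f).
have [u [v [duv _]]] := octahedral (dist_rot1 df) (dist_rot1 dg) (dist_rot1 dk).
exists E, C, k, (g \oc f), l; split=> //.
have [a' [b' [c' d']]] := dist_unshift duv.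
by exists A, B, a', b', c'.
Qed.

(** Two classes that can be exchanged have an extension-closed product:
   [(P * Q) * (P * Q)] is regrouped as [P * (Q * P) * Q]. *)
Lemma ext_closed_ext P Q :
  ext_closed P -> ext_closed Q -> subcat_incl (ext Q P) (ext P Q) ->
  ext_closed (ext P Q).
Proof.
move=> PP QQ QP X.
move=> /ext_assoc_r/(ext_mono (fun Y (p : P Y) => p) (@ext_assoc_l _ _ _)).
move=> /(ext_mono (fun Y (p : P Y) => p) (ext_mono QP (fun Y (q : Q Y) => q))).
move=> /(ext_mono (fun Y (p : P Y) => p) (@ext_assoc_r _ _ _)).
by move=> /ext_assoc_l; apply: ext_mono.
Qed.

Lemma ext_closed_subcategory P :
  iso_closed P -> (forall X, is_zero X -> P X) -> ext_closed P ->
  is_subcategory P.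
Proof.
move=> Pi P0 PP; split=> // X Y B /dist_biproduct [f [g [h d]]] PX PY.
by apply: PP; exists X, Y, f, g, h.
Qed.

Lemma ext_inl P Q (X O : D) : is_zero O -> Q O -> P X -> ext P Q X.
Proof.
by move=> O0 QO PX; exists X, O, (idm X), 0, 0; split=> //; apply: dist_id.
Qed.

Lemma ext_inr P Q (X O : D) : is_zero O -> P O -> Q X -> ext P Q X.
Proof.
move=> O0 PO QX; exists O, X, 0, (idm X), 0; split=> //.
by apply: dist_rotV; rewrite fmap0 oppr0; apply/dist_id/shift_zero.
Qed.

End Extensions.

(** * Orthogonal pairs *)

Section TorsionPairs.
Variable D : triangulated.
Implicit Types P Q : subcat D.

(** The t-structure axioms, formulated for the pair itself: they hold for both
   [(D^{<=0}, D^{>=1})] and [(D^{<=-1}, D^{>=0})], so closure properties are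
   proved once for the two. *)
Record t_pair P Q : Prop := TPair {
  t_pair_isol : iso_closed P;
  t_pair_isor : iso_closed Q;
  t_pair_shift : forall X, P X -> P X[1];
  t_pair_orth : forall X Y (f : hom X Y), P X -> Q Y -> f = 0;
  t_pair_trunc : forall X, ext P Q X
}.

Variables P Q : subcat D.
Hypothesis PQ : t_pair P Q.

(** The map from [X] to its truncation in [Q] is zero, so the truncation in [P]
   maps isomorphically onto [X]. *)
Lemma t_pair_perp_l (X : D) :
  (forall Y (f : hom X Y), Q Y -> f = 0) -> P X.
Proof.
move=> XQ; have [A [B [f [g [h [d PA QB]]]]]] := t_pair_trunc PQ X.
apply: (t_pair_isol PQ _ PA); exists f; apply: (dist_zero_snd d (XQ _ _ QB)).
by move=> u; apply: (t_pair_orth PQ u (t_pair_shift PQ PA) QB).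
Qed.

Lemma t_pair_perp_r (X : D) :
  (forall Y (f : hom Y X), P Y -> f = 0) -> Q X.
Proof.
move=> PX; have [A [B [f [g [h [d PA QB]]]]]] := t_pair_trunc PQ X.
apply: (t_pair_isor PQ _ QB); apply: isomorphic_sym.
exists g; apply: (dist_zero_fst d (PX _ _ PA)).
by move=> u; apply: (t_pair_orth PQ u (t_pair_shift PQ PA) QB).
Qed.

Lemma t_pair_ext_l : ext_closed P.
Proof.
move=> X [A [B [f [g [h [d PA PB]]]]]]; apply: t_pair_perp_l => Y w QY.
have [u <-] := dist_factor_r d (t_pair_orth PQ (w \oc f) PA QY).
by rewrite (t_pair_orth PQ u PB QY) comp0l.
Qed.

Lemma t_pair_ext_r : ext_closed Q.
Proof.
move=> X [A [B [f [g [h [d QA QB]]]]]]; apply: t_pair_perp_r => Y w PY.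
have [u <-] := dist_factor_l d (t_pair_orth PQ (g \oc w) PY QB).
by rewrite (t_pair_orth PQ u PY QA) comp0r.
Qed.

Lemma t_pair_zero_l (X : D) : is_zero X -> P X.
Proof. by case=> X0 _; apply: t_pair_perp_l => Y f _; apply: X0. Qed.

Lemma t_pair_zero_r (X : D) : is_zero X -> Q X.
Proof. by case=> _ X0; apply: t_pair_perp_r => Y f _; apply: X0. Qed.

End TorsionPairs.

(** * The aisle and the heart *)

Section TStructure.
Variables (D : triangulated) (t : t_structure D).

Local Notation le0 := (tle0 t).
Local Notation lt0 := (tle t (-1)).
Local Notation ge0 := (tge t 0).

Lemma lt0_shift (X : D) : le0 X -> lt0 X[1].
Proof. by move=> X0; exists X => //; apply: isomorphic_refl. Qed.

Lemma lt0_le0 (X : D) : lt0 X -> le0 X.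
Proof. exact: (@tle0_shift _ t X). Qed.

Lemma t_pair_lt0 : t_pair lt0 ge0.
Proof.
have [Pi _ _] := tle0_subcategory t; split.
- by move=> X Y XY [Z Z0 XZ]; exists Z => //;
    apply: isomorphic_trans XZ; apply: isomorphic_sym.
- by move=> X Y XY [Z Z0 XZ]; exists Z => //;
    apply: isomorphic_trans XZ; apply: isomorphic_sym.
- by move=> X /lt0_le0; apply: lt0_shift.
- move=> X Y f [X' X0 [a ai]] [Y' Y1 [b bi]].
  apply: (iso_mono bi); rewrite comp0r.
  have [a' [a'a aa']] := ai.
  have [g eg] := shift_full (b \oc f \oc a').
  rewrite -(comp_idr (b \oc f)) -a'a compA -eg.
  by rewrite (t_orth g X0 Y1) fmap0 oppr0 comp0l.
- move=> X; apply: ext_iso (isomorphic_sym (shift_ess_surj X)) _.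
  have [A [B [f [g [h [/dist_shift [f' [g' [h' d]]] A0 B1]]]]]] :=
    t_trunc t (unshift D X).
  exists A[1], B[1], f', g', h'; split=> //; first exact: lt0_shift.
  by exists B => //; apply: isomorphic_refl.
Qed.

Lemma t_pair_le0 : t_pair le0 (tge1 t).
Proof.
have [Pi _ _] := tle0_subcategory t; have [Qi _ _] := tge1_subcategory t.
split=> //; first by move=> X /lt0_shift/lt0_le0.
- by move=> X Y f; apply: t_orth.
- exact: t_trunc.
Qed.

Lemma le0_rot (X Y Z : D) (f : hom X Y) (g : hom Y Z) (h : hom Z X[1]) :
  distinguished f g h -> le0 X -> le0 Y -> le0 Z.
Proof.
move=> /dist_rot1 d X0 Y0; apply: (t_pair_ext_l t_pair_le0).
exists Y, X[1], g, h, (- fmap (shift D) f); split=> //.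
exact/lt0_le0/lt0_shift.
Qed.

(** The difference of [u] and [v] factors through [X[1]], which is in
   [D^{<=-1}] and has no nonzero map to [W]. *)
Lemma dist_epi_ge0 (X Y Z W : D) (f : hom X Y) (g : hom Y Z) (h : hom Z X[1])
    (u v : hom Z W) :
  distinguished f g h -> le0 X -> ge0 W -> u \oc g = v \oc g -> u = v.
Proof.
move=> d X0 W0 e; apply/eqP; rewrite -subr_eq0; apply/eqP.
have [w <-] : exists w : hom X[1] W, w \oc h = u - v.
  by apply: (dist_factor_r (dist_rot1 d)); rewrite compDl compNl e subrr.
by rewrite (t_pair_orth t_pair_lt0 w (lt0_shift X0) W0) comp0l.
Qed.

(** Dual to [dist_epi_ge0]. The argument is shifted once, so that it involves
   maps from [W[1]] to [Z] instead of maps from [W] to [Z[-1]]. *)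
Lemma dist_mono_le0 (X Y Z W : D) (f : hom X Y) (g : hom Y Z) (h : hom Z X[1])
    (u v : hom W X) :
  distinguished f g h -> ge0 Z -> le0 W -> f \oc u = f \oc v -> u = v.
Proof.
move=> d Z0 W0 e; apply: shift_faithful.
apply/eqP; rewrite -subr_eq0; apply/eqP.
have [w <-] : exists w : hom W[1] Z,
    h \oc w = fmap (shift D) u - fmap (shift D) v.
  apply: (dist_factor_l (dist_rot1 (dist_rot1 d))).
  by rewrite compNl compDr compNr -!fmap_comp e subrr oppr0.
by rewrite (t_pair_orth t_pair_lt0 w (lt0_shift W0) Z0) comp0r.
Qed.

Definition heart_mem : subcat D := fun X => le0 X /\ ge0 X.

Lemma heart_mem_iso : iso_closed heart_mem.
Proof.
move=> X Y XY [X0 X1]; split; first exact: (t_pair_isol (t_pair_le0) XY).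
exact: (t_pair_isor (t_pair_lt0) XY).
Qed.

Lemma heart_mem_ext : ext_closed heart_mem.
Proof.
move=> X [A [B [f [g [h [d [A0 A1] [B0 B1]]]]]]]; split.
  by apply: (t_pair_ext_l t_pair_le0); exists A, B, f, g, h.
by apply: (t_pair_ext_r t_pair_lt0); exists A, B, f, g, h.
Qed.

Lemma heart_mem_zero (X : D) : is_zero X -> heart_mem X.
Proof.
move=> X0; split; first exact: (t_pair_zero_l t_pair_le0).
exact: (t_pair_zero_r t_pair_lt0).
Qed.

Lemma trunc_heart (X A B : D) (f : hom A X) (g : hom X B) (h : hom B A[1]) :
  distinguished f g h -> lt0 A -> ge0 B -> le0 X -> heart_mem B.
Proof. by move=> d A0 B0 X0; split=> //; apply: (le0_rot d (lt0_le0 A0)). Qed.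

(** Factorizations through a triangle always exist; on the heart they are
   unique because the neighbouring terms of the long exact Hom sequences, in
   degree [-1], vanish. *)
Lemma dist_short_exact (X Y Z : heart t)
    (f : hom X Y) (g : hom Y Z) (h : hom (sval Z) (sval X)[1]) :
  @distinguished D (sval X) (sval Y) (sval Z) f g h -> short_exact f g.
Proof.
case: (svalP X) => X0 X1; case: (svalP Y) => Y0 Y1; case: (svalP Z) => Z0 Z1.
move=> d; split; split; try exact: (dist_comp0 d).
  move=> W w gw; have [u fu] := dist_factor_l d gw; exists u; split=> // v fv.
  by apply: (dist_mono_le0 d Z1 (svalP W).1); rewrite fu.
move=> W w wf; have [u ug] := dist_factor_r d wf; exists u; split=> // v vg.
by apply: (dist_epi_ge0 d X0 (svalP W).2); rewrite ug.
Qed.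

(** The composite [p g : Y -> C -> B] of a cone of [f] with its truncation is a
   cokernel of [f] with respect to objects of [D^{>=0}]; the two lemmas are the
   existence and the uniqueness in its universal property. *)
Section RightExact.
Variables (X Y C A B : D) (f : hom X Y) (g : hom Y C) (h : hom C X[1]).
Variables (a : hom A C) (p : hom C B) (c : hom B A[1]).
Hypotheses (fgh : distinguished f g h) (apc : distinguished a p c).
Hypotheses (X0 : le0 X) (A0 : lt0 A).

Lemma trunc_cone_factor (W : D) (w : hom Y W) :
  ge0 W -> w \oc f = 0 -> exists u : hom B W, u \oc (p \oc g) = w.
Proof.
move=> W0 /(dist_factor_r fgh) [v <-].
have [u <-] := dist_factor_r apc (t_pair_orth t_pair_lt0 (v \oc a) A0 W0).
by exists u; rewrite compA.
Qed.

Lemma trunc_cone_epi (W : D) (u v : hom B W) :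
  ge0 W -> u \oc (p \oc g) = v \oc (p \oc g) -> u = v.
Proof.
move=> W0; rewrite !compA => /(dist_epi_ge0 fgh X0 W0).
exact: (dist_epi_ge0 apc (lt0_le0 A0) W0).
Qed.

End RightExact.

(** The composite [Y -> Q -> H^0 Q] is zero because [g] is an epimorphism, and
   it is an epimorphism as a cokernel of [g]; hence [H^0 Q = 0]. *)
Lemma heart_epi_cone (X Y : heart t) (g : hom X Y) (Q : D)
    (q : hom (sval Y) Q) (r : hom Q (sval X)[1]) :
  is_epi g -> @distinguished D (sval X) (sval Y) Q g q r -> lt0 Q.
Proof.
move=> ge d; have [[X0 _] [Y0 _]] := (svalP X, svalP Y).
have [A [B [a [p [c [apc A0 B0]]]]]] := t_pair_trunc t_pair_lt0 Q.
pose H : heart t := exist _ B (trunc_heart apc A0 B0 (le0_rot d X0 Y0)).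
have pq0 : p \oc q = 0.
  apply: (ge H); rewrite /= comp0l -compA (dist_comp0 d).
  exact: comp0r.
have B_zero : is_zero B.
  apply: is_zeroP; apply: (trunc_cone_epi d apc X0 A0 B0).
  by rewrite pq0 !comp0r.
apply: (t_pair_perp_l t_pair_lt0) => W w W0.
have [u <-] := dist_factor_r apc (t_pair_orth t_pair_lt0 (w \oc a) A0 W0).
by rewrite (B_zero.1 _ u) comp0l.
Qed.

(** * From torsion classes to preaisles *)

Section OfTorsion.
Variable T : subcat (heart t).
Hypothesis torT : is_torsion_class T.

Definition heart_image : subcat D :=
  fun X => exists p : heart_mem X, T (exist _ X p : heart t).

Definition preaisle_of : subcat D := ext lt0 heart_image.

Lemma heart_imageE (X : heart t) : heart_image (sval X) <-> T X.
Proof.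
case: X => X p; split=> [[q]|TX]; last by exists p.
by rewrite (Prop_irrelevance q p).
Qed.

Lemma heart_image_iso : iso_closed heart_image.
Proof.
have [[Ti _ _] _ _] := torT => X Y XY [p TX].
exists (heart_mem_iso XY p); apply: Ti TX.
exact: XY.
Qed.

Lemma heart_image_zero (X : D) : is_zero X -> heart_image X.
Proof.
have [[_ T0 _] _ _] := torT => X0; exists (heart_mem_zero X0); apply: T0.
by case: X0 => X0 X0'; split=> Y f; [apply: X0|apply: X0'].
Qed.

Lemma heart_image_ext : ext_closed heart_image.
Proof.
have [_ Te _] := torT => X [A [B [f [g [h [d [pA TA] [pB TB]]]]]]].
have pX : heart_mem X by apply: heart_mem_ext; exists A, B, f, g, h.
exists pX.
pose A' : heart t := exist _ A pA; pose B' : heart t := exist _ B pB.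
pose X' : heart t := exist _ X pX.
exact: (Te A' X' B' f g (@dist_short_exact A' X' B' _ _ _ d) TA TB).
Qed.

(** Let [B -> X -> A -> B[1]] be a triangle with [B] in [T] and [A] in
   [D^{<=-1}]. Then [B -> X -> H^0 X] is an epimorphism of the heart, since the
   cones of both maps have no nonzero map to the heart; thus [H^0 X] is a
   quotient of [B]. *)
Lemma ext_heart_image_lt0 :
  subcat_incl (ext heart_image lt0) (ext lt0 heart_image).
Proof.
have [_ _ Tq] := torT => X [B [A [f [g [h [d [pB TB] A0]]]]]].
have X0 : le0 X.
  apply: (t_pair_ext_l t_pair_le0); exists B, A, f, g, h; split=> //.
    by have [] := pB.
  exact: lt0_le0.
have [A' [H [a [p [c [apc A'0 H0]]]]]] := t_pair_trunc t_pair_lt0 X.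
have pH := trunc_heart apc A'0 H0 X0.
have pf_epi (W : D) (u v : hom H W) :
    ge0 W -> u \oc (p \oc f) = v \oc (p \oc f) -> u = v.
  move=> W0 /eqP; rewrite !compA -subr_eq0 -compNl -compDl => /eqP e.
  apply: (dist_epi_ge0 apc (lt0_le0 A'0) W0).
  apply/eqP; rewrite -subr_eq0; apply/eqP; have [w <-] := dist_factor_r d e.
  by rewrite (t_pair_orth t_pair_lt0 w A0 W0) comp0l.
exists A', H, a, p, c; split=> //; exists pH.
apply: (Tq _ _ (p \oc f : @hom (heart t) (exist _ B pB) (exist _ H pH)) _ TB).
by move=> W u v; apply: pf_epi; case: (svalP W).
Qed.

Lemma preaisle_of_lt0 : subcat_incl lt0 preaisle_of.
Proof.
have [[O O0] _] := tri_additive D.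
by move=> X; apply: (ext_inl O0); apply: heart_image_zero.
Qed.

Lemma preaisle_of_le0 : subcat_incl preaisle_of le0.
Proof.
move=> X; move/(ext_mono lt0_le0 (Q' := le0)) => H.
by apply: (t_pair_ext_l t_pair_le0); apply: H => Y [[]].
Qed.

Lemma preaisle_of_preaisle : is_preaisle preaisle_of.
Proof.
have Uext : ext_closed preaisle_of.
  apply: ext_closed_ext; first exact: (t_pair_ext_l t_pair_lt0).
    exact: heart_image_ext.
  exact: ext_heart_image_lt0.
split.
- apply: ext_closed_subcategory Uext; first exact: ext_iso.
  by move=> X /(t_pair_zero_l t_pair_lt0)/preaisle_of_lt0.
- by move=> X Y Z f g h d UX UZ; apply: Uext; exists X, Z, f, g, h.
- move=> X [Y /preaisle_of_le0 Y0 XY]; apply: preaisle_of_lt0.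
  by exists Y.
Qed.

Lemma preaisle_of_intermediate : is_intermediate_preaisle t preaisle_of.
Proof.
split; [exact: preaisle_of_preaisle|exact: preaisle_of_lt0|].
exact: preaisle_of_le0.
Qed.

(** In a triangle [A -> X -> B] with [X] in the heart, [A] in [D^{<=-1}] and [B]
   in [T], the first map is zero, so [X] is isomorphic to [B]. *)
Lemma preaisle_of_heart (X : heart t) : preaisle_of (sval X) <-> T X.
Proof.
split=> [[A [B [f [g [h [d A0 TB]]]]]]|/heart_imageE TX]; last first.
  have [[O O0] _] := tri_additive D.
  by apply: (ext_inr O0) => //; apply: (t_pair_zero_l t_pair_lt0).
apply/heart_imageE; have [[_ B0] _] := TB.
apply: heart_image_iso TB; apply: isomorphic_sym; exists g.
apply: (dist_zero_fst d (t_pair_orth t_pair_lt0 f A0 (svalP X).2)) => u.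
by apply: (t_pair_orth t_pair_lt0 u _ B0); apply: (t_pair_shift t_pair_lt0).
Qed.

End OfTorsion.

(** * From preaisles to torsion classes *)

Section OfPreaisle.
Variable U : subcat D.
Hypothesis intU : is_intermediate_preaisle t U.

Definition torsion_of : subcat (heart t) := fun X => U (sval X).

Lemma intermediate_ext : ext_closed U.
Proof.
have [[_ Ue _] _ _] := intU => X [A [B [f [g [h [d UA UB]]]]]].
exact: (Ue _ _ _ _ _ _ d).
Qed.

(** For a short exact sequence [X -> Y -> Z] of the heart, [Z] is isomorphic to
   [H^0] of the cone of [f], both being cokernels of [f]. Hence the cone is in
   [U], and so is [Y], an extension of the cone by [X]. *)
Lemma torsion_of_torsion : is_torsion_class torsion_of.
Proof.
have [[[Ui U0 Ub] _ _] Ult _] := intU; split.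
- split.
  + by move=> X Y XY; apply: Ui.
  + by move=> X [X0 _]; apply: U0; apply: is_zeroP; apply: (X0 X).
  + by move=> X Y B XYB; apply: Ub.
- move=> X Y Z f g [_ [gf fg]] UX UZ.
  have [[X0 _] [Y0 _]] := (svalP X, svalP Y).
  have [C [k [l d]]] := @dist_cone D (sval X) (sval Y) f.
  have [A [B [a [p [c [apc A0 B0]]]]]] := t_pair_trunc t_pair_lt0 C.
  have coker_g (W : D) (w : hom (sval Y) W) : heart_mem W -> w \oc f = 0 ->
      exists! u : hom (sval Z) W, u \oc g = w.
    by move=> HW; apply: (fg (exist _ W HW)).
  have [v [vg _]] : exists! v : hom (sval Z) B, v \oc g = p \oc k.
    apply: coker_g; first exact: (trunc_heart apc A0 B0 (le0_rot d X0 Y0)).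
    by rewrite -compA (dist_comp0 d) comp0r.
  have [u upk] : exists u : hom B (sval Z), u \oc (p \oc k) = g.
    by apply: (trunc_cone_factor d apc A0) gf; case: (svalP Z).
  have ZB : isomorphic (sval Z) B.
    exists v, u; split.
      have [w [_ wu]] := coker_g _ _ (svalP Z) gf.
      rewrite -(wu (idm (sval Z)) (comp_idl _)); apply: esym; apply: wu.
      by rewrite -compA vg.
    apply: (trunc_cone_epi d apc X0 A0 B0).
    by rewrite -compA upk comp_idl.
  apply: intermediate_ext; exists (sval X), C, f, k, l; split=> //.
  apply: intermediate_ext; exists A, B, a, p, c; split=> //; first exact: Ult.
  exact: Ui UZ.
- move=> X Y g ge UX.
  have [Q [q [r d]]] := @dist_cone D (sval X) (sval Y) g.
  apply: intermediate_ext; exists (sval X), Q, g, q, r; split=> //.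
  by apply: Ult; apply: (heart_epi_cone ge d).
Qed.

(** For [X] in [U] with truncation [A -> X -> B], the rotated triangle
   [X -> B -> A[1]] shows that [B] is in [U]. *)
Lemma preaisle_of_torsion_of (X : D) : preaisle_of torsion_of X <-> U X.
Proof.
have [[_ _ Us] Ult U0] := intU; split=> [|UX].
  move/(ext_mono Ult (Q' := U)) => H; apply: intermediate_ext.
  by apply: H => Y [].
have [A [B [a [p [c [apc A0 B0]]]]]] := t_pair_trunc t_pair_lt0 X.
exists A, B, a, p, c; split=> //.
exists (trunc_heart apc A0 B0 (U0 _ UX)).
rewrite /torsion_of /=; apply: intermediate_ext.
exists X, A[1], p, c, (- fmap (shift D) a); split=> //.
  exact: dist_rot1.
by apply: Us; exists A; [exact: Ult|exact: isomorphic_refl].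
Qed.

End OfPreaisle.

End TStructure.

Theorem corollary4p12 (D : triangulated) (t : t_structure D) :
  t_nondegenerate t ->
  exists F : {T : subcat (heart t) | is_torsion_class T} ->
             {U : subcat D | is_intermediate_preaisle t U},
    bijective F.
Proof.
move=> _.
pose F (T : {T : subcat (heart t) | is_torsion_class T}) :
    {U : subcat D | is_intermediate_preaisle t U} :=
  exist _ (preaisle_of (sval T)) (preaisle_of_intermediate (svalP T)).
pose G (U : {U : subcat D | is_intermediate_preaisle t U}) :
    {T : subcat (heart t) | is_torsion_class T} :=
  exist _ (torsion_of (sval U)) (torsion_of_torsion (svalP U)).
exists F, G => [[T torT]|[U intU]]; apply: eq_exist; apply: funext => X;
  apply: propext; first exact: (preaisle_of_heart torT).
exact: (preaisle_of_torsion_of intU).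
Qed.
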